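(* Let $n\geq 1$ be an integer and $\beta=1-\frac{1}{2^{n+1}}$. Let $\mathcal{P}$ be the set of primes, $\Omega=[0,1]^{\mathcal{P}}$ with elements $\omega=(\omega_p)_{p\in\mathcal{P}}$, $\mathcal{F}$ its Borel $\sigma$-algebra and $\mathbb{P}$ the product of Lebesgue measures. For every $\alpha\in[1/2,1]$ let $f_\alpha(\cdot,\omega)$ be the multiplicative function supported on the squarefree integers with $f_\alpha(p,\omega)=-1$ if $\omega_p\in[0,\alpha]$ and $f_\alpha(p,\omega)=+1$ if $\omega_p\in(\alpha,1]$, and let $F_\alpha(s,\omega)=\sum_{m=1}^\infty \frac{f_\alpha(m,\omega)}{m^s}$ for $\mathrm{Re}(s)>1$. Then there exists a measure-preserving transformation $T:\Omega\to\Omega$ such that $T^{2^n}$ is the identity and such that for all $s$ with $\mathrm{Re}(s)>1$ and all $\omega\in\Omega$, $$\frac{1}{\zeta(s)^{2^n-1}}=\frac{1}{F_{1/2}(s,\omega)}\prod_{k=1}^{2^n}F_\beta(s,T^k\omega),$$ where $\zeta$ is the Riemann zeta function.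
   Context: A function $f:\mathbb{N}\to\mathbb{C}$ is multiplicative if $f(nm)=f(n)f(m)$ whenever $\gcd(n,m)=1$ (with $f(1)=1$); it is supported on the squarefree integers if $f(p^k)=0$ for every prime $p$ and every $k\geq 2$. $T$ is measure-preserving means $\mathbb{P}(T^{-1}(A))=\mathbb{P}(A)$ for all $A\in\mathcal{F}$. Under $\mathbb{P}$, $(f_\alpha(p))_{p}$ are i.i.d. with $\mathbb{P}(f_\alpha(p)=-1)=\alpha=1-\mathbb{P}(f_\alpha(p)=+1)$. *)

(* Defs.v *)
From HB Require Import structures.
From mathcomp Require Import all_boot all_order all_algebra.
From mathcomp Require Import all_classical all_reals all_analysis.
From mathcomp Require Export complex.

Set Implicit Arguments.
Unset Strict Implicit.
Unset Printing Implicit Defensive.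

Import Order.TTheory GRing.Theory Num.Theory.
Import numFieldNormedType.Exports.

Local Open Scope classical_set_scope.
Local Open Scope ring_scope.
Local Open Scope complex_scope.

Definition primeT : Type := {p : nat | prime p}.

HB.instance Definition _ := Countable.on primeT.

Section sample_space.
Variable R : realType.

(* [0, 1] with the topology induced by R *)
Definition unit_itv : Type := set_type (`[0, 1]%classic : set R).

HB.instance Definition _ := Topological.on unit_itv.

Lemma unit_itv0 : (0 : R) \in (`[0, 1]%classic : set R).
Proof. by rewrite inE/= in_itv/= lexx ler01. Qed.

(* measurable types are required to be inhabited *)
HB.instance Definition _ := isPointed.Build unit_itv (SigSub unit_itv0).

Definition unit_val (x : unit_itv) : R := set_val x.

(* [0, 1]^primes with the product topology *)
Definition Omega_top := prod_topology (fun _ : primeT => unit_itv).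

HB.instance Definition _ := Pointed.copy Omega_top (forall _ : primeT, unit_itv).

(* the same space with its Borel sigma-algebra *)
Definition Omega := g_sigma_algebraType (@open Omega_top).

(* The product of the Lebesgue measures on [0, 1] is the unique probability
   measure satisfying the product rule on measurable cylinders. *)
Definition is_product_lebesgue (P : set Omega -> \bar R) : Prop :=
  forall (J : seq primeT) (A : primeT -> set R),
    uniq J -> (forall p, measurable (A p)) ->
    P [set w | forall p, p \in J -> A p (unit_val (w p))] =
    (\prod_(p <- J) lebesgue_measure (A p `&` `[0%R, 1%R]))%E.

End sample_space.

Definition measure_preserving d (X : measurableType d) (R : realType)
    (P : {measure set X -> \bar R}) (T : X -> X) : Prop :=
  measurable_fun setT T /\
  forall A, measurable A -> P (T @^-1` A) = P A.

(* The value at 0 is irrelevant: arithmetic functions live on m >= 1. *)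
Definition multiplicative_fun (C : nzRingType) (f : nat -> C) : Prop :=
  f 1%N = 1 /\
  forall m n, (0 < m)%N -> (0 < n)%N -> coprime m n ->
    f (m * n)%N = f m * f n.

Definition squarefree_supported (C : nzRingType) (f : nat -> C) : Prop :=
  forall p k, prime p -> (2 <= k)%N -> f (p ^ k)%N = 0.

Section dirichlet.
Variable R : realType.

Definition expC (z : R[i]) : R[i] :=
  (expR (complex.Re z))%:C * (cos (complex.Im z) +i* sin (complex.Im z)).

Definition powC (m : nat) (s : R[i]) : R[i] := expC (s * (ln (m%:R : R))%:C).

(* sum_{m >= 1} a(m) / m^s, as the limit of its partial sums for the modulus
   (the topology of R[i]^o) *)
Definition dirichlet_series (a : nat -> R[i]) (s : R[i]) : R[i] :=
  limn (fun N : nat => (\sum_(1 <= m < N.+1) a m / powC m s : R[i]^o)).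

(* only used for Re s > 1 *)
Definition riemann_zeta (s : R[i]) : R[i] := dirichlet_series (fun=> 1) s.

Definition is_random_multiplicative (alpha : R) (f : nat -> Omega R -> R[i]) :
    Prop :=
  forall w : Omega R,
    [/\ multiplicative_fun (f^~ w),
        squarefree_supported (f^~ w),
        (forall p : primeT, unit_val (w p) \in `[0, alpha] -> f (val p) w = -1)
      & (forall p : primeT, unit_val (w p) \in `]alpha, 1] -> f (val p) w = 1)].

End dirichlet.

(* Main.v *)
Require Import Defs.
From mathcomp Require Import all_boot all_order all_algebra.
From mathcomp Require Import all_classical all_reals all_analysis.
From mathcomp Require Import measurable_realfun ring lra zify.

Set Implicit Arguments.
Unset Strict Implicit.
Unset Printing Implicit Defensive.
Import Order.TTheory GRing.Theory Num.Theory.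
Import numFieldNormedType.Exports.

Local Open Scope classical_set_scope.
Local Open Scope ring_scope.
Local Open Scope complex_scope.

(** Put [d = 1 / 2 ^ n.+1], so that [beta = 1 - d]. The map [T] acts on each
    coordinate as the identity on [[0, 1/2]] and permutes cyclically, by
    translations, the [2 ^ n] intervals of length [d] that make up [(1/2, 1]].
    Hence along the first [2 ^ n] iterates a coordinate [<= 1/2] never exceeds
    [beta] while a coordinate [> 1/2] exceeds it exactly once, which is the
    claimed identity for each Euler factor.

    To pass to the Dirichlet series, sieve by the primes [<= y]: each series is
    the finite Euler product over these primes times the sum restricted to the
    integers without prime factor [<= y] (for zeta the factors are inverted),
    and that restricted sum tends to [1].

    [T] preserves the measure because Lebesgue measure is translation invariant
    and the cylinders form a pi-system generating the Borel sets: every open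
    set is a countable union of finite-dimensional boxes with rational sides. *)

(** * Dominated complex series *)

Section complex_series.
Variable R : realType.
Implicit Types (u h : nat -> R[i]) (b : nat -> R) (l z : R[i]).

Lemma normC_real (x : R) : `|x%:C| = `|x|%:C.
Proof. by rewrite normc_def /= expr0n /= addr0 sqrtr_sqr. Qed.

Lemma normC_le_ReIm z :
  `|z| <= (`|complex.Re z| + `|complex.Im z|)%:C.
Proof.
rewrite {1}[z]complexE (le_trans (ler_normD _ _))// normrM.
have -> : `|'i%C : R[i]| = 1.
  by rewrite normc_def/= expr0n/= add0r expr1n sqrtr1.
by rewrite mul1r !normC_real -rmorphD.
Qed.

Lemma normC_ge_Im z : `|complex.Im z|%:C <= `|z|.
Proof.
by rewrite normc_def lecR -(sqrtr_sqr (complex.Im z)) ler_wsqrtr // lerDr sqr_ge0.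
Qed.

Lemma cvg_complex u l :
  complex.Re (u n) @[n --> \oo] --> complex.Re l ->
  complex.Im (u n) @[n --> \oo] --> complex.Im l ->
  (u : nat -> R[i]^o) @ \oo --> (l : R[i]^o).
Proof.
move=> /cvgrPdist_lt uRe /cvgrPdist_lt uIm; apply/cvgrPdist_lt => e e0.
have eE : e = (complex.Re e)%:C by rewrite RRe_real// ger0_real// ltW.
have e20 : 0 < complex.Re e / 2.
  by rewrite divr_gt0// -ltcR -eE.
near=> n.
have nRe : `|complex.Re l - complex.Re (u n)| < complex.Re e / 2.
  by near: n; exact: uRe.
have nIm : `|complex.Im l - complex.Im (u n)| < complex.Re e / 2.
  by near: n; exact: uIm.
apply: le_lt_trans (normC_le_ReIm _) _.
rewrite eE ltcR (splitr (complex.Re e)).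
by rewrite [complex.Re (l - u n)]raddfB [complex.Im (l - u n)]raddfB ltrD.
Unshelve. all: by end_near. Qed.

Lemma abs_cvg_series (v : nat -> R) b : (forall n, `|v n| <= b n) ->
  cvgn (series b) -> cvgn (series v) /\ `|limn (series v)| <= limn (series b).
Proof.
move=> vb cb.
have b0 n : 0 <= b n by exact: le_trans (vb n).
have cv : cvgn [normed series v].
  exact: (@series_le_cvg _ (fun n => `|v n|) b (fun=> normr_ge0 _) b0 vb cb).
split; first exact: normed_cvg.
apply: le_trans (lim_series_norm cv) _.
apply: ler_lim => //; near=> n; rewrite /series/=.
by apply: ler_sum => k _; exact: vb.
Unshelve. all: by end_near. Qed.

Lemma Re_series h n :
  complex.Re (series h n) = series (fun k => complex.Re (h k)) n.
Proof. by rewrite /series/= raddf_sum. Qed.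

Lemma Im_series h n :
  complex.Im (series h n) = series (fun k => complex.Im (h k)) n.
Proof. by rewrite /series/= raddf_sum. Qed.

Definition csum h : R[i] := limn (series h : nat -> R[i]^o).

Definition dominated b h := forall n, `|h n| <= (b n)%:C.

(** Real and imaginary parts are summed separately, each bounded by the sum of [b]. This is the
    origin of the factor 2, harmless since the bound is later applied to tails. *)
Lemma dominated_csum b h : dominated b h -> cvgn (series b) ->
  (series h : nat -> R[i]^o) @ \oo --> (csum h : R[i]^o) /\
  `|csum h| <= (limn (series b) *+ 2)%:C.
Proof.
move=> hb cb.
have hRe n : `|complex.Re (h n)| <= b n.
  by rewrite -lecR (le_trans (normc_ge_Re _)).
have hIm n : `|complex.Im (h n)| <= b n.
  by rewrite -lecR (le_trans (normC_ge_Im _)).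
have [cRe nRe] := abs_cvg_series hRe cb.
have [cIm nIm] := abs_cvg_series hIm cb.
pose l := limn (series (fun k => complex.Re (h k))) +i*
          limn (series (fun k => complex.Im (h k))).
have hl : (series h : nat -> R[i]^o) @ \oo --> (l : R[i]^o).
  apply: cvg_complex => /=.
    by under eq_fun do rewrite Re_series.
  by under eq_fun do rewrite Im_series.
have -> : csum h = l by exact: cvg_lim hl.
split => //; apply: le_trans (normC_le_ReIm _) _.
by rewrite lecR mulr2n lerD.
Qed.

Lemma dominatedW b h h' : dominated b h ->
  (forall n, h' n = h n \/ h' n = 0) -> dominated b h'.
Proof.
move=> hb hh' n; case: (hh' n) => ->; first exact: hb.
by rewrite normr0 (le_trans _ (hb n)).
Qed.

Lemma csumE h l : (series h : nat -> R[i]^o) @ \oo --> (l : R[i]^o) ->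
  csum h = l.
Proof. exact: cvg_lim. Qed.

Lemma sum_multiples (p N : nat) h : (0 < p)%N ->
  \sum_(0 <= m < p * N) (if (p %| m)%N then h m else 0) =
  \sum_(0 <= k < N) h (p * k)%N.
Proof.
move=> p0; elim: N => [|N IH]; first by rewrite muln0 !big_geq.
rewrite mulnS addnC (big_cat_nat (n := p * N))//= ?leq_addr// IH big_nat_recr//=.
congr (_ + _); rewrite -{1}[(p * N)%N]add0n big_addn addKn.
(* In the block of [p] indices starting at [p * N], only the first is a multiple of [p]. *)
rewrite big_ltn// add0n dvdn_mulr// big_nat_cond big1 ?addr0// => i.
move=> /andP[/andP[i0 ip] _].
by rewrite (dvdn_addl _ (dvdn_mulr _ (dvdnn p))) gtnNdvd.
Qed.

(** Restricting [h] to the multiples of [p], or to the other integers, keeps it dominated by [b], so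
    both parts converge. The partial sums of [h (p * k)] are those of the multiples part along the
    subsequence [p * N]. *)
Lemma csum_multiples b (p : nat) h : (0 < p)%N -> dominated b h ->
  cvgn (series b) ->
  csum h = csum (fun m => if (p %| m)%N then 0 else h m) +
           csum (fun k => h (p * k)%N).
Proof.
move=> p0 hb cb.
pose h1 m := if (p %| m)%N then 0 else h m.
pose h2 m := if (p %| m)%N then h m else 0.
have [c _] := dominated_csum hb cb.
have h1b : dominated b h1.
  by apply: dominatedW hb _ => m; rewrite /h1; case: ifP; [right|left].
have h2b : dominated b h2.
  by apply: dominatedW hb _ => m; rewrite /h2; case: ifP; [left|right].
have [c1 _] := dominated_csum h1b cb.
have [c2 _] := dominated_csum h2b cb.
have -> : csum (fun k => h (p * k)%N) = csum h2.
  apply: csumE.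
  have -> : series (fun k => h (p * k)%N) = (fun N => series h2 (p * N)%N).
    by apply/funext => N; rewrite /series/= sum_multiples.
  apply: (cvg_comp (fun N => p * N)%N _ _ c2).
  apply/cvgnyPge => A; near=> N.
  by apply: (@leq_trans N); [near: N; exact: nbhs_infty_ge|exact: leq_pmull].
apply: csumE; have -> : series h = (fun N => series h1 N + series h2 N).
  apply/funext => N; rewrite /series/= -big_split/=; apply: eq_bigr => m _.
  by rewrite /h1 /h2; case: ifP; rewrite ?add0r ?addr0.
exact: (@cvgD _ R[i]^o _ _ _ _ _ _ _ c1 c2).
Unshelve. all: by end_near. Qed.

Lemma csumZ b h (a : R[i]) : dominated b h -> cvgn (series b) ->
  csum (fun k => a * h k) = a * csum h.
Proof.
move=> hb cb; have [c _] := dominated_csum hb cb.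
apply: csumE; have -> : series (fun k => a * h k) = (fun N => a * series h N).
  by apply/funext => N; rewrite /series/= mulr_sumr.
exact: (@cvgM _ _ _ _ (fun=> a) _ a _ (cvg_cst _) c).
Qed.

End complex_series.

(** * Sieving a multiplicative sum by the primes up to [y] *)

Section rough_sums.
Variables (R : realType) (b : nat -> R) (h : nat -> R[i]).
Hypotheses (hb : dominated b h) (cb : cvgn (series b)).
Hypotheses (h0 : h 0%N = 0) (h1 : h 1%N = 1).
Hypothesis hM : forall m n, (0 < m)%N -> (0 < n)%N -> coprime m n ->
  h (m * n)%N = h m * h n.

(* [coprime m y`!] says that [m] has no prime factor [<= y]. *)
Definition rough y m : R[i] := if coprime m y`! then h m else 0.

Lemma dominated_rough y : dominated b (rough y).
Proof. by apply: dominatedW hb _ => m; rewrite /rough; case: ifP; [left|right]. Qed.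

Lemma roughS_prime y m : prime y.+1 ->
  rough y.+1 m = if (y.+1 %| m)%N then 0 else rough y m.
Proof.
move=> py; rewrite /rough factS coprimeMr coprime_sym prime_coprime//.
by case: (y.+1 %| m)%N.
Qed.

(** A prime factor of a non-prime [y.+1] is at most [y], so it already divides the factorial of
    [y]. *)
Lemma roughS_composite y : ~~ prime y.+1 -> rough y.+1 = rough y.
Proof.
move=> npy; apply/funext => m; rewrite /rough factS coprimeMr andbC.
case: (boolP (coprime m y`!)) => //= cmy.
suff -> : coprime m y.+1 by [].
case: y npy cmy => [|y] npy cmy; first by rewrite coprimen1.
rewrite coprime_has_primes//; last first.
  (* If [m = 0], coprimality forces the factorial to be 1, hence [y = 0]; but then [y.+2 = 2] is
     prime. *)
  rewrite lt0n; apply/negP => /eqP m0; move: cmy; rewrite m0.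
  rewrite /coprime gcd0n => /eqP f1.
  by case: y npy f1 => // y _ /eqP; rewrite factS muln_eq1.
apply/hasPn => q; rewrite mem_primes => /andP[pq /andP[_ qy]].
rewrite mem_primes pq/=; apply/negP => /andP[m0 qm].
have qley : (q <= y.+1)%N.
  rewrite -ltnS ltn_neqAle dvdn_leq// andbT.
  by apply/negP => /eqP qE; rewrite qE (negbTE npy) in pq.
have qf : (q %| y.+1`!)%N by rewrite dvdn_fact// prime_gt0.
have : (q %| gcdn m y.+1`!)%N by rewrite dvdn_gcd qm qf.
by move/eqP: cmy => ->; rewrite Euclid_dvd1.
Qed.

Lemma csum_rough_prime y : prime y.+1 -> csum (rough y) =
  csum (rough y.+1) + csum (fun k => rough y (y.+1 * k)%N).
Proof.
move=> py; rewrite (csum_multiples (p := y.+1) _ (dominated_rough y) cb)//.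
by congr (csum _ + _); apply/funext => m; rewrite roughS_prime.
Qed.

Lemma coprime_prime_fact y : prime y.+1 -> coprime y.+1 y`!.
Proof.
move=> py; rewrite prime_coprime//.
have: forall j, (j <= y)%N -> ~~ (y.+1 %| j`!)%N.
  elim=> [|j IH] jy; first by rewrite fact0 Euclid_dvd1.
  by rewrite factS Euclid_dvdM// negb_or IH ?(ltnW jy)// andbT gtnNdvd.
exact.
Qed.

Lemma rough_primeM y k : prime y.+1 ->
  rough y (y.+1 * k)%N = if coprime k y`! then h (y.+1 * k)%N else 0.
Proof. by move=> py; rewrite /rough coprimeMl coprime_prime_fact. Qed.

(** With [p = y.+1], the term at [p * k] is [h p * h k] when [p] does not divide [k], and 0
    otherwise, the exponent of [p] being then at least 2. So the multiples of [p] account for [h p]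
    times the sum already sieved by [p]. *)
Lemma csum_rough_squarefree y :
  (forall p k, prime p -> (2 <= k)%N -> h (p ^ k)%N = 0) -> prime y.+1 ->
  csum (rough y) = (1 + h y.+1) * csum (rough y.+1).
Proof.
move=> hsf py; rewrite csum_rough_prime// mulrDl mul1r; congr (_ + _).
rewrite -(csumZ _ (dominated_rough y.+1) cb); congr csum; apply/funext => k.
rewrite rough_primeM// roughS_prime// /rough.
have [->|k0] := posnP k; first by rewrite muln0 h0 dvdn0 mulr0 if_same.
case: (boolP (y.+1 %| k)%N) => [pk|npk]; last first.
  case: ifP => _; last by rewrite mulr0.
  by rewrite hM// prime_coprime.
suff -> : h (y.+1 * k)%N = 0 by rewrite mulr0 if_same.
(* Split off the full power of [y.+1]: its exponent is at least 2, so [h] vanishes on it. *)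
have yk0 : (0 < y.+1 * k)%N by rewrite muln_gt0.
rewrite -(partnC y.+1 yk0) hM ?part_gt0 ?coprime_partC//.
rewrite p_part hsf ?mul0r// lognM// logn_prime// eqxx add1n ltnS.
by rewrite logn_gt0 mem_primes py k0.
Qed.

(** Here the multiples of [y.+1] contribute [h y.+1] times the sum not yet sieved by [y.+1], which
    is why the Euler factor appears inverted. *)
Lemma csum_rough_completely_multiplicative y :
  (forall m n, (0 < m)%N -> (0 < n)%N -> h (m * n)%N = h m * h n) ->
  prime y.+1 -> csum (rough y.+1) = (1 - h y.+1) * csum (rough y).
Proof.
move=> hcm py; apply/esym; rewrite mulrBl mul1r {1}csum_rough_prime//.
rewrite -[RHS]addr0 -addrA; congr (_ + _); apply/eqP; rewrite subr_eq0; apply/eqP.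
rewrite -(csumZ _ (dominated_rough y) cb); congr csum; apply/funext => k.
rewrite rough_primeM// /rough.
have [->|k0] := posnP k; first by rewrite muln0 h0 !if_same mulr0.
by case: ifP => _; rewrite ?mulr0// hcm.
Qed.

Lemma rough0 : rough 0 = h.
Proof. by apply/funext => m; rewrite /rough fact0 coprimen1. Qed.

Lemma euler_product_squarefree y :
  (forall p k, prime p -> (2 <= k)%N -> h (p ^ k)%N = 0) ->
  csum h = (\prod_(p < y.+1 | prime p) (1 + h p)) * csum (rough y).
Proof.
move=> hsf; elim: y => [|y IH].
  by rewrite rough0 big_mkcond big_ord_recl big_ord0 /= !mul1r.
rewrite IH [in RHS]big_mkcond big_ord_recr/= -big_mkcond/=.
case: ifPn => py; first by rewrite csum_rough_squarefree// mulrA.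
by rewrite roughS_composite// mulr1.
Qed.

Lemma euler_product_completely_multiplicative y :
  (forall m n, (0 < m)%N -> (0 < n)%N -> h (m * n)%N = h m * h n) ->
  (\prod_(p < y.+1 | prime p) (1 - h p)) * csum h = csum (rough y).
Proof.
move=> hcm; elim: y => [|y IH].
  by rewrite rough0 big_mkcond big_ord_recl big_ord0 /= !mul1r.
rewrite big_mkcond big_ord_recr/= -big_mkcond/= mulrAC IH.
case: ifPn => py; last by rewrite roughS_composite// mulr1.
by rewrite csum_rough_completely_multiplicative// mulrC.
Qed.

(** Besides [m = 1], the surviving terms all have [m > y], so the distance to 1 is controlled by a
    tail of the series of [b]. *)
Lemma cvg_csum_rough :
  (fun y => csum (rough y) : R[i]^o) @ \oo --> (1 : R[i]^o).
Proof.
(* With the indices up to [y] removed, the sum of [b] is exactly that tail. *)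
pose by_ y m : R := if (m <= y)%N then 0 else b m.
have b0 m : 0 <= b m.
  by rewrite -ler0c (le_trans _ (hb m)).
have seriesE y N : (y < N)%N -> series (by_ y) N = series b N - series b y.+1.
  move=> yN; rewrite /series/= (big_cat_nat (n := y.+1))//=.
  rewrite [in RHS](big_cat_nat (n := y.+1))//= addrAC subrr add0r.
  rewrite big_nat_cond big1 ?add0r; last first.
    by move=> i /andP[/andP[_]]; rewrite ltnS /by_ => ->.
  rewrite big_nat_cond [in RHS]big_nat_cond; apply: eq_bigr => i.
  by move=> /andP[/andP[yi _] _]; rewrite /by_ leqNgt yi.
have cby y : series (by_ y) @ \oo --> limn (series b) - series b y.+1.
  have c : (fun N => series b N - series b y.+1) @ \oo -->
      limn (series b) - series b y.+1 by apply: cvgB => //; exact: cvg_cst.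
  apply: cvg_trans c; apply: near_eq_cvg; near=> N.
  by rewrite seriesE//; near: N; exact: nbhs_infty_gt.
have tail : (limn (series b) - series b y.+1) *+ 2 @[y --> \oo] --> (0 : R).
  rewrite -(mul0rn _ 2) -(subrr (limn (series b))); apply: cvgMn.
  apply: cvgB; first exact: cvg_cst.
  by rewrite (cvg_shiftS (series b)).
have bound y : `|csum (rough y) - 1| <=
    ((limn (series b) - series b y.+1) *+ 2)%:C.
  pose r m := if m == 1%N then 0 else rough y m.
  have rE m : (m <= y)%N -> r m = 0.
    rewrite /r /rough; case: eqVneq => // m1 my.
    have [->|m0] := posnP m; first by rewrite h0 if_same.
    (* For [1 < m <= y], [m] itself divides the factorial of [y], so the two are not coprime. *)
    case: ifP => // cm; have : (m %| gcdn m y`!)%N.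
      by rewrite dvdn_gcd dvdnn dvdn_fact// m0.
    by move/eqP: cm => ->; rewrite dvdn1 (negbTE m1).
  have rb : dominated (by_ y) r.
    move=> m; rewrite /by_; case: leqP => [/rE ->|_]; first by rewrite normr0.
    apply: (@dominatedW _ b _ r (dominated_rough y)) => k; rewrite /r.
    by case: ifP; [right|left].
  have [cr nr] := dominated_csum rb (cvgP _ (cby y)).
  rewrite (cvg_lim _ (cby y))// in nr; apply: le_trans nr.
  rewrite le_eqVlt; apply/orP; left; apply/eqP; congr (`|_|).
  apply/eqP; rewrite subr_eq addrC; apply/eqP; apply: csumE.
  have c : (fun N => 1 + series r N : R[i]^o) @ \oo --> (1 + csum r : R[i]^o).
    by apply: (@cvgD _ R[i]^o _ _ _ (fun=> 1) _ 1 _ (cvg_cst _) cr).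
  apply: cvg_trans c; apply: near_eq_cvg; near=> N.
  have N1 : (1 < N)%N by near: N; exact: nbhs_infty_gt.
  rewrite /series/= (bigD1_seq 1%N) ?mem_index_iota ?iota_uniq//=.
  rewrite [in RHS](bigD1_seq 1%N) ?mem_index_iota ?iota_uniq//=.
  rewrite {1}/r eqxx add0r /rough /coprime gcd1n eqxx h1; congr (_ + _).
  by apply: eq_bigr => i /negbTE i1; rewrite /r i1.
apply/cvgrPdist_lt => e e0.
have eE : e = (complex.Re e)%:C by rewrite RRe_real// ger0_real// ltW.
have Re0 : 0 < complex.Re e by rewrite -ltcR -eE.
move/cvgrPdist_lt/(_ _ Re0): tail; apply: filterS => y.
rewrite sub0r normrN => yb; rewrite distrC (le_lt_trans (bound y))//.
by rewrite eE ltcR (le_lt_trans (ler_norm _)).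
Unshelve. all: by end_near. Qed.

End rough_sums.

(** * Dirichlet series and Euler products for Re s > 1 *)

Section dirichlet_series_facts.
Variable R : realType.
Implicit Types (s : R[i]) (a : nat -> R[i]).

Lemma expCD (x y : R[i]) : expC (x + y) = expC x * expC y.
Proof.
case: x => a b; case: y => c d; rewrite /expC /= expRD cosD sinD.
by simpc; congr (_ +i* _); ring.
Qed.

Lemma normC_expC (z : R[i]) : `|expC z| = (expR (complex.Re z))%:C.
Proof.
have nE t : `|(cos t +i* sin t : R[i])| = 1.
  by rewrite normc_def /= cos2Dsin2 sqrtr1.
by rewrite /expC normrM nE mulr1 normC_real (ger0_norm (expR_ge0 _)).
Qed.

Lemma powCM (m n : nat) s : (0 < m)%N -> (0 < n)%N ->
  powC (m * n) s = powC m s * powC n s.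
Proof.
move=> m0 n0; rewrite /powC natrM lnM ?posrE ?ltr0n// rmorphD/= mulrDr.
exact: expCD.
Qed.

Lemma normC_powC (m : nat) s :
  `|powC m s| = (expR (complex.Re s * ln m%:R))%:C.
Proof. by rewrite /powC normC_expC; case: s => a b /=; rewrite mulr0 subr0. Qed.

Lemma powC1 s : powC 1 s = 1.
Proof. by rewrite /powC ln1 mulr0 /expC /= expR0 cos0 sin0; simpc. Qed.

(** The dominating term [m ^ (- sigma)], in the exponential form matching [normC_powC]. *)
Definition pseries_term (sigma : R) (m : nat) : R :=
  if m == 0%N then 0 else expR (- (sigma * ln m%:R)).

Lemma pseries_term_ge0 sigma m : 0 <= pseries_term sigma m.
Proof. by rewrite /pseries_term; case: ifP => // _; exact: expR_ge0. Qed.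

(** Cauchy condensation: the block from [2 ^ J] up to [2 ^ J.+1] has [2 ^ J] terms, each at most
    [2 ^ (- sigma J)]. *)
Lemma dyadic_pseries_le (sigma : R) J : 0 <= sigma ->
  series (pseries_term sigma) (2 ^ J)%N <=
  series (geometric 1 (2 * expR (- (sigma * ln 2)))) J.
Proof.
move=> s0; elim: J => [|J IH].
  by rewrite /series/= expn0 big_nat1 big_geq.
have -> : (2 ^ J.+1 = 2 ^ J + 2 ^ J)%N by rewrite expnS mul2n addnn.
rewrite {1}/series/= (big_cat_nat (n := (2 ^ J)%N))//= ?leq_addr//.
rewrite [leRHS]seriesSr; apply: lerD; first exact: IH.
apply: (@le_trans _ _ (\sum_(2 ^ J <= i < 2 ^ J + 2 ^ J)
    expR (- (sigma * ln (2 ^ J)%N%:R)))).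
  rewrite big_nat_cond [leRHS]big_nat_cond; apply: ler_sum => i.
  move=> /andP[/andP[Ji _] _].
  have i0 : (0 < i)%N by apply: leq_trans Ji; rewrite expn_gt0.
  rewrite /pseries_term gtn_eqF// ler_expR lerN2 ler_wpM2l//.
  by rewrite ler_ln ?posrE ?ltr0n ?expn_gt0// ler_nat.
rewrite big_const_nat addKn iter_addr_0 /geometric/= mul1r exprMn.
rewrite -expRM_natl natrX lnXn// -[X in X <= _]mulr_natl natrX.
rewrite le_eqVlt; apply/orP; left; apply/eqP; congr (_ * expR _).
by rewrite -mulr_natl; ring.
Qed.

Lemma is_cvg_pseries (sigma : R) : 1 < sigma ->
  cvgn (series (pseries_term sigma)).
Proof.
move=> s1; have s0 : 0 <= sigma by rewrite ltW// (lt_trans _ s1).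
set q := 2 * expR (- (sigma * ln 2)).
have q0 : 0 < q by rewrite mulr_gt0// expR_gt0.
(* The condensed series is geometric of ratio [2 ^ (1 - sigma)]. *)
have q1 : q < 1.
  have -> : q = expR ((1 - sigma) * ln 2).
    rewrite mulrBl mul1r expRD lnK// posrE//.
  by rewrite expR_lt1 nmulr_rlt0 ?subr_lt0// ln_gt0// ltr1n.
apply: nondecreasing_is_cvgn.
  by apply: nondecreasing_series => n _ _; exact: pseries_term_ge0.
exists (1 / (1 - q)) => _ [N _ <-].
apply: (@le_trans _ _ (series (pseries_term sigma) (2 ^ N)%N)).
  have := @nondecreasing_series _ (pseries_term sigma) xpredT.
  move=> /(_ 0%N (fun n _ _ => pseries_term_ge0 _ _)); apply.
  exact/ltnW/ltn_expl.
apply: le_trans (dyadic_pseries_le N s0) _; rewrite -/q.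
rewrite geometric_seriesE ?lt_eqF//= ler_pM2r ?invr_gt0 ?subr_gt0//.
by rewrite mul1r gerBl exprn_ge0// ltW.
Qed.

(** [csum] starts at index 0 and a Dirichlet series at index 1; the value 0 at 0 reconciles them,
    whatever [a 0] is. *)
Definition dirichlet_term a s m : R[i] := if m == 0%N then 0 else a m / powC m s.

Lemma dominated_dirichlet_term a s : (forall m, (0 < m)%N -> `|a m| <= 1) ->
  dominated (pseries_term (complex.Re s)) (dirichlet_term a s).
Proof.
move=> a1 m; rewrite /pseries_term /dirichlet_term.
have [m0|m0] := posnP m; first by rewrite normr0.
rewrite normrM normfV normC_powC expRN -fmorphV/=.
by rewrite ler_piMl ?a1// ler0c invr_ge0 expR_ge0.
Qed.

Lemma dirichlet_seriesE a s : 1 < complex.Re s ->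
  (forall m, (0 < m)%N -> `|a m| <= 1) ->
  dirichlet_series a s = csum (dirichlet_term a s).
Proof.
move=> s1 a1.
have [c _] := dominated_csum (dominated_dirichlet_term s a1) (is_cvg_pseries s1).
rewrite /dirichlet_series; set u := (X in lim (X @ _)).
suff -> : u = (fun N => series (dirichlet_term a s) N.+1 : R[i]^o).
  have c' : (fun N => series (dirichlet_term a s) N.+1 : R[i]^o) @ \oo -->
      (csum (dirichlet_term a s) : R[i]^o).
    by rewrite (@cvg_shiftS R[i]^o (series (dirichlet_term a s))).
  exact: cvg_lim c'.
apply/funext => N; rewrite /u /series/= [in RHS]big_ltn//.
rewrite [X in X + _]/dirichlet_term eqxx add0r.
rewrite big_nat_cond [in RHS]big_nat_cond; apply: eq_bigr => m.
by move=> /andP[/andP[m0 _] _]; rewrite /dirichlet_term gtn_eqF.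
Qed.

(** Strong induction, stripping off the full power of the smallest prime factor [p]: it is either
    [p] itself or a higher power, where [a] vanishes. *)
Lemma norm_multiplicative_squarefree a :
  multiplicative_fun a -> squarefree_supported a ->
  (forall p, prime p -> `|a p| <= 1) -> forall m, (0 < m)%N -> `|a m| <= 1.
Proof.
move=> [a1 aM] asf ap m; elim/ltn_ind: m => m IH m0.
have [m1|m1] := leqP m 1.
  have -> : m = 1%N by apply/eqP; rewrite eqn_leq m1.
  by rewrite a1 normr1.
set p := pdiv m; have pp : prime p by exact: pdiv_prime.
rewrite -(partnC p m0) aM ?part_gt0 ?coprime_partC// normrM.
have pm : (0 < logn p m)%N by rewrite logn_gt0 mem_primes pp m0 pdiv_dvd.
have m'm : (m`_p^' < m)%N.
  rewrite -{2}(partnC p m0) ltn_Pmull ?part_gt0// p_part.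
  by rewrite -(expn0 p) ltn_exp2l// prime_gt1.
apply: mulr_ile1 => //; last by apply: IH; rewrite ?part_gt0.
rewrite p_part; case: (logn p m) pm => // -[|k] _; first by rewrite expn1 ap.
by rewrite asf// normr0 ler01.
Qed.

Lemma norm_prime_powC (p : nat) s : prime p -> 1 < complex.Re s ->
  `|(powC p s)^-1| < 1.
Proof.
move=> pp s1; rewrite normfV normC_powC -(rmorph1 (real_complex R)) -fmorphV ltcR.
rewrite invf_lt1 ?expR_gt0// expR_gt1 mulr_gt0 ?(lt_trans _ s1)// ln_gt0//.
by rewrite ltr1n prime_gt1.
Qed.

Lemma cvg_prod_ones (u : nat -> nat -> R[i]) (r : seq nat) :
  (forall k, (u k : nat -> R[i]^o) @ \oo --> (1 : R[i]^o)) ->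
  (fun y => \prod_(k <- r) u k y : R[i]^o) @ \oo --> (1 : R[i]^o).
Proof.
move=> cu; elim: r => [|k r IH].
  by under eq_fun do rewrite big_nil; exact: cvg_cst.
have c : (fun y => u k y * \prod_(i <- r) u i y : R[i]^o) @ \oo -->
    (1 * 1 : R[i]^o) by exact: (@cvgM _ _ _ _ _ _ _ _ (cu k) IH).
rewrite mulr1 in c; suff -> : (fun y => \prod_(i <- k :: r) u i y) =
  (fun y => u k y * \prod_(i <- r) u i y) by exact: c.
by apply/funext => y; rewrite big_cons.
Qed.

(** Supplies a level [y] at which a sieved sum is nonzero; the nonvanishing of the full series is
    deduced from it. *)
Lemma cvg1_neq0 (u : nat -> R[i]) : (u : nat -> R[i]^o) @ \oo --> (1 : R[i]^o) ->
  exists y, u y != 0.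
Proof.
move=> /cvgrPdist_lt/(_ 1 ltr01)[y _ /(_ y (leqnn y))/= uy].
exists y; apply/eqP => u0; move: uy; rewrite u0 subr0 normr1.
by rewrite ltxx.
Qed.


Lemma dirichlet_euler_squarefree a s y : 1 < complex.Re s ->
  multiplicative_fun a -> squarefree_supported a ->
  (forall p, prime p -> `|a p| <= 1) ->
  dirichlet_series a s = (\prod_(p < y.+1 | prime p) (1 + a p / powC p s)) *
     csum (rough (dirichlet_term a s) y) /\
  (fun y => csum (rough (dirichlet_term a s) y) : R[i]^o) @ \oo --> (1 : R[i]^o).
Proof.
move=> s1 aM asf ap.
have a1 := norm_multiplicative_squarefree aM asf ap.
have hb := dominated_dirichlet_term s a1.
have cb := is_cvg_pseries s1.
have h1 : dirichlet_term a s 1 = 1 by rewrite /dirichlet_term aM.1 powC1 divr1.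
have hM m n : (0 < m)%N -> (0 < n)%N -> coprime m n ->
    dirichlet_term a s (m * n)%N = dirichlet_term a s m * dirichlet_term a s n.
  move=> m0 n0 cmn; rewrite /dirichlet_term muln_eq0 !gtn_eqF//=.
  by rewrite aM.2// powCM// invfM mulrACA.
split; last exact: (cvg_csum_rough hb cb).
rewrite dirichlet_seriesE// (euler_product_squarefree hb cb _ hM y)//.
  congr (_ * _); apply: eq_bigr => p pp.
  by rewrite /dirichlet_term gtn_eqF// prime_gt0.
move=> p k pp k2; rewrite /dirichlet_term expn_eq0 (gtn_eqF (prime_gt0 pp))/=.
by rewrite asf// mul0r.
Qed.

(** The Euler factors stay as multipliers of zeta: in this form a zero of zeta would make every
    sieved sum vanish, contradicting the limit 1. *)
Lemma zeta_euler s y : 1 < complex.Re s ->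
  (\prod_(p < y.+1 | prime p) (1 - (powC p s)^-1)) * riemann_zeta s =
     csum (rough (dirichlet_term (fun=> 1) s) y) /\
  (fun y => csum (rough (dirichlet_term (fun=> 1) s) y) : R[i]^o) @ \oo -->
    (1 : R[i]^o).
Proof.
move=> s1; have a1 (m : nat) : (0 < m)%N -> `|1 : R[i]| <= 1 by rewrite normr1.
have hb := dominated_dirichlet_term s a1.
have cb := is_cvg_pseries s1.
have h1 : dirichlet_term (fun=> 1) s 1 = 1.
  by rewrite /dirichlet_term powC1 divr1.
have hM m n : (0 < m)%N -> (0 < n)%N -> dirichlet_term (fun=> 1) s (m * n)%N =
    dirichlet_term (fun=> 1) s m * dirichlet_term (fun=> 1) s n.
  move=> m0 n0; rewrite /dirichlet_term muln_eq0 !gtn_eqF//=.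
  by rewrite powCM// invfM !mul1r.
split; last exact: (cvg_csum_rough hb cb).
rewrite -(euler_product_completely_multiplicative hb cb _ y)//.
rewrite /riemann_zeta dirichlet_seriesE//.
congr (_ * _); apply: eq_bigr => p pp.
by rewrite /dirichlet_term gtn_eqF ?prime_gt0// mul1r.
Qed.

Lemma riemann_zeta_neq0 s : 1 < complex.Re s -> riemann_zeta s != 0.
Proof.
move=> s1; have [_ /cvg1_neq0[y]] := zeta_euler 0 s1.
by have [<- _] := zeta_euler y s1; rewrite mulf_eq0 negb_or => /andP[].
Qed.

Lemma dirichlet_squarefree_neq0 a s : 1 < complex.Re s ->
  multiplicative_fun a -> squarefree_supported a ->
  (forall p, prime p -> `|a p| <= 1) -> dirichlet_series a s != 0.
Proof.
move=> s1 aM asf ap.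
have [_ /cvg1_neq0[y y0]] := dirichlet_euler_squarefree 0 s1 aM asf ap.
have [-> _] := dirichlet_euler_squarefree y s1 aM asf ap.
(* No Euler factor vanishes, because [a p / powC p s] has modulus less than 1. *)
rewrite mulf_neq0//; apply/prodf_neq0 => p pp; apply/eqP => ap0.
have : `|a p / powC p s| < 1.
  rewrite normrM (le_lt_trans _ (norm_prime_powC pp s1))//.
  by rewrite ler_piMl// ap.
have -> : a p / powC p s = -1 by apply/eqP; rewrite -addr_eq0 addrC ap0.
by rewrite normrN1 ltxx.
Qed.

(** Reduces the identity to one between Euler factors, polynomial in [x], which stands for
    [p ^ (- s)]. At each level [y] the finite Euler products match exactly, leaving only sieved
    sums, which tend to 1. *)
Lemma dirichlet_series_prod (a0 : nat -> R[i]) (a : nat -> nat -> R[i]) K s :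
  1 < complex.Re s ->
  multiplicative_fun a0 -> squarefree_supported a0 ->
  (forall p, prime p -> `|a0 p| <= 1) ->
  (forall k, multiplicative_fun (a k)) ->
  (forall k, squarefree_supported (a k)) ->
  (forall k p, prime p -> `|a k p| <= 1) ->
  (forall p x, prime p -> \prod_(1 <= k < K.+1) (1 + a k p * x) =
     (1 + a0 p * x) * (1 - x) ^+ (K - 1)) ->
  1 / riemann_zeta s ^+ (K - 1) =
  1 / dirichlet_series a0 s * \prod_(1 <= k < K.+1) dirichlet_series (a k) s.
Proof.
move=> s1 a0M a0sf a0p aM asf ap local_factors.
pose r0 y := csum (rough (dirichlet_term a0 s) y).
pose r k y := csum (rough (dirichlet_term (a k) s) y).
pose rz y := csum (rough (dirichlet_term (fun=> 1) s) y).
have F0 y := dirichlet_euler_squarefree y s1 a0M a0sf a0p.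
have Fk k y := dirichlet_euler_squarefree y s1 (aM k) (asf k) (ap k).
have Z y := zeta_euler y s1.
(* Cross-multiplied form, in which only the sieved sums depend on [y]. The power of [rz y] is
   written as a product over [K - 1] dummy indices so that [cvg_prod_ones] applies to it. *)
have key y :
    (riemann_zeta s ^+ (K - 1) * \prod_(1 <= k < K.+1) dirichlet_series (a k) s) *
    r0 y =
    dirichlet_series a0 s *
    ((\prod_(k <- nseq (K - 1) 0%N) rz y) * \prod_(1 <= k < K.+1) r k y).
  rewrite (eq_bigr _ (fun k _ => (Fk k y).1)) big_split/= exchange_big/=.
  rewrite (eq_bigr (fun p : 'I_y.+1 => (1 + a0 p / powC p s) *
      (1 - (powC p s)^-1) ^+ (K - 1))); last first.
    by move=> p pp; exact: local_factors.
  rewrite big_split/= prodrXl (F0 y).1 big_nseq iter_mulr_1 -/(r0 y).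
  rewrite -[rz y](Z y).1 exprMn.
  rewrite -/(\prod_(1 <= k < K.+1) r k y).
  ring.
have eqF : riemann_zeta s ^+ (K - 1) *
    \prod_(1 <= k < K.+1) dirichlet_series (a k) s = dirichlet_series a0 s.
  set A := _ * _; set B := dirichlet_series a0 s.
  have c1 : (fun y => A * r0 y : R[i]^o) @ \oo --> (A * 1 : R[i]^o).
    exact: (@cvgM _ _ _ _ (fun=> A) _ A _ (cvg_cst _) (F0 0%N).2).
  have c2 : (fun y => B * ((\prod_(k <- nseq (K - 1) 0%N) rz y) *
      \prod_(1 <= k < K.+1) r k y) : R[i]^o) @ \oo --> (B * (1 * 1) : R[i]^o).
    apply: (@cvgM _ _ _ _ (fun=> B) _ B _ (cvg_cst _)).
    apply: (@cvgM R[i]).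
      exact: (@cvg_prod_ones (fun=> rz) _ (fun=> (Z 0%N).2)).
    exact: (@cvg_prod_ones r _ (fun k => (Fk k 0%N).2)).
  rewrite !mulr1 in c1 c2.
  apply: (@cvg_unique R[i]^o _ _ _ _ _ c1); first exact: norm_hausdorff.
  by rewrite (funext key : (fun y => A * r0 y) = _).
have z0 : riemann_zeta s ^+ (K - 1) != 0 by rewrite expf_neq0// riemann_zeta_neq0.
have f0 := dirichlet_squarefree_neq0 s1 a0M a0sf a0p.
by apply: (mulfI z0); rewrite mul1r divff// mulrCA eqF mul1r mulVf.
Qed.

End dirichlet_series_facts.

(** * The rotation of the upper half of the unit interval *)

Section interval_rotation.
Variable R : realType.
Implicit Types (d x t : R) (A : set R).
Local Notation mu := (@lebesgue_measure R).

Lemma measurable_fun_shift (c : R) : measurable_fun setT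
  (fun x : measurableTypeR R => x + c : measurableTypeR R).
Proof. exact: measurable_funD. Qed.

Lemma measurable_shift (c : R) A : measurable A ->
  measurable [set x : R | A (x + c)].
Proof.
by move=> mA; rewrite -[X in measurable X]setTI; exact: measurable_fun_shift.
Qed.

(** The image of [mu] under translation agrees with [mu] on half-open intervals, which determine
    Lebesgue measure. *)
Lemma lebesgue_measure_shift (c : R) A : measurable A ->
  mu [set x : R | A (x + c)] = mu A.
Proof.
move=> mA; apply/esym.
pose nu := measure_function_pushforward__canonical__measure_function_Measure
  mu (measurable_fun_shift c).
rewrite (@lebesgue_measure_unique _ nu)//.
move=> _ [[a b] _ <-] /=; rewrite /pushforward/=.
have -> : (fun x : R => x + c) @^-1` `]a, b] = `]a - c, b - c]%classic.
  by apply/seteqP; split => x /=; rewrite !in_itv/= ltrBlDr lerBrDr.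
rewrite !lebesgue_measure_itv/= !lte_fin ltrD2r; case: ifP => // _.
by rewrite -!EFinB; congr EFin; ring.
Qed.

(* Identity on [<= 1/2]; on [(1/2, 1]] it permutes cyclically the consecutive
   intervals [(1/2 + j d, 1/2 + (j + 1) d]]. *)
Definition rotate d x : R :=
  if x <= 1 / 2 then x else if x <= 1 - d then x + d else x + (d - 1 / 2).

Lemma preimage_rotate d A : rotate d @^-1` A =
  (A `&` [set` `]-oo, 1 / 2]]) `|`
  (([set x | A (x + d)] `&` [set` `]1 / 2, +oo[]) `&` [set` `]-oo, 1 - d]]) `|`
  (([set x | A (x + (d - 1 / 2))] `&` [set` `]1 / 2, +oo[])
     `&` [set` `]1 - d, +oo[]).
Proof.
apply/seteqP; split => x; rewrite /rotate /= !in_itv/= !andbT.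
  case: (leP x (1 / 2)) => x2; first by left; left.
  by case: (leP x (1 - d)) => xd Ax; [left; right|right].
by case: (leP x (1 / 2)) => x2; case: (leP x (1 - d)) => xd;
  move=> [[[? ?]|[[? ?] ?]]|[[? ?] ?]].
Qed.

Lemma measurable_rotate d A : measurable A -> measurable (rotate d @^-1` A).
Proof.
move=> mA; rewrite preimage_rotate.
by repeat (apply: measurableU || apply: measurableI);
  rewrite //; exact: measurable_shift.
Qed.

(** The intervals [(1/2, 1 - d]] and [(1 - d, 1]] are translated onto [(1/2 + d, 1]] and
    [(1/2, 1/2 + d]], which again partition [(1/2, 1]]. Additivity and translation invariance on
    each piece conclude. *)
Lemma lebesgue_measure_rotate d A : 0 < d -> d <= 1 / 2 -> measurable A ->
  mu (rotate d @^-1` A `&` `[0, 1]) = mu (A `&` `[0, 1]).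
Proof.
move=> d0 d2 mA.
have mI (i : interval R) : measurable (A `&` [set` i]) by exact: measurableI.
have -> : A `&` `[0, 1] = (A `&` `[0, 1 / 2]) `|`
    ((A `&` `](1 / 2 + d), 1]) `|` (A `&` `](1 / 2), (1 / 2 + d)])).
  apply/seteqP; split => x /=; rewrite !in_itv/=.
    move=> [Ax /andP[x0 x1]]; rewrite x0 x1/= andbT.
    case: (leP x (1 / 2)) => x2; first by left.
    by right; case: (leP x (1 / 2 + d)) => xd; [right|left].
  by case=> [[? /andP[? ?]]|[[? /andP[? ?]]|[? /andP[? ?]]]]; split => //; lra.
(* The preimage is cut along the three branches of [rotate]; each piece is a translate of the
   matching piece of [A]. *)
have -> : rotate d @^-1` A `&` `[0, 1] = (A `&` `[0, 1 / 2]) `|`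
    ([set x | (A `&` `](1 / 2 + d), 1]) (x + d)] `|`
     [set x | (A `&` `](1 / 2), (1 / 2 + d)]) (x + (d - 1 / 2))]).
  apply/seteqP; split => x /=; rewrite /rotate !in_itv/=.
    case: (leP x (1 / 2)) => x2.
      by move=> [Ax /andP[x0 x1]]; left; split => //; apply/andP; split.
    case: (leP x (1 - d)) => xd [Ax /andP[x0 x1]]; right; [left|right];
      by split => //; apply/andP; split; lra.
  case=> [[Ax /andP[x0 x1]]|[[Ax /andP[x0 x1]]|[Ax /andP[x0 x1]]]].
  - by rewrite x1; split => //; lra.
  - rewrite ifF; last by apply/negbTE; rewrite -ltNge; lra.
    by rewrite ifT; [split => //|]; lra.
  - rewrite ifF; last by apply/negbTE; rewrite -ltNge; lra.
    by rewrite ifF; [split => //; lra|apply/negbTE; rewrite -ltNge; lra].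
have mS c (i : interval R) : measurable [set x | (A `&` [set` i]) (x + c)].
  exact: measurable_shift.
have U3 (X Y Z : set R) : measurable X -> measurable Y -> measurable Z ->
    X `&` (Y `|` Z) = set0 -> Y `&` Z = set0 ->
    mu (X `|` (Y `|` Z)) = (mu X + (mu Y + mu Z))%E.
  move=> mX mY mZ XYZ YZ; rewrite measureU//; last exact: measurableU.
  by rewrite measureU.
rewrite !U3//; first by rewrite !(lebesgue_measure_shift _ (mI _)).
all: rewrite -subset0 => x /=; rewrite !in_itv/=.
- by move=> [[? /andP[? ?]] [[? /andP[? ?]]|[? /andP[? ?]]]]; lra.
- by move=> [[? /andP[? ?]] [? /andP[? ?]]]; lra.
- by move=> [[? /andP[? ?]] [[? /andP[? ?]]|[? /andP[? ?]]]]; lra.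
- by move=> [[? /andP[? ?]] [? /andP[? ?]]]; lra.
Qed.

Lemma rotate_itv d x : 0 < d -> d <= 1 / 2 -> 0 <= x <= 1 -> 0 <= rotate d x <= 1.
Proof.
move=> d0 d2 /andP[x0 x1]; rewrite /rotate.
by case: (leP x (1 / 2)) => ?; [|case: (leP x (1 - d)) => ?];
  apply/andP; split; lra.
Qed.

(** * Orbits of the rotation through the [2 ^ n] cells *)

Section orbits.
Variables (n : nat).
Local Notation N := (2 ^ n)%N.
Local Notation d := (1 / 2 ^+ n.+1 : R).

Lemma stepM_card : d * N%:R = 1 / 2.
Proof. by rewrite natrX exprS; field; rewrite expf_neq0. Qed.

Lemma step_gt0 : 0 < d.
Proof. by rewrite divr_gt0// exprn_gt0. Qed.

Lemma step_le_half : d <= 1 / 2.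
Proof.
by rewrite -stepM_card ler_peMr ?(ltW step_gt0)// ler1n expn_gt0.
Qed.

(** The offset [t] will range over [(0, d]], the cells being open on the left and closed on the
    right. *)
Definition cell j t : R := 1 / 2 + j%:R * d + t.

Lemma rotate_cell j t : (j < N)%N -> 0 < t <= d ->
  rotate d (cell j t) = cell (j.+1 %% N) t.
Proof.
move=> jN /andP[t0 td]; have d0 := step_gt0; have dN := stepM_card.
have jd : 0 <= j%:R * d by rewrite mulr_ge0// ltW.
rewrite /rotate ifF; last by apply/negbTE; rewrite -ltNge /cell; lra.
(* The last cell wraps around to cell 0; every other cell moves to its successor. *)
move: jN; rewrite leq_eqVlt => /orP[/eqP jN|jN].
  rewrite jN modnn ifF; last first.
    apply/negbTE; rewrite -ltNge /cell.
    by move: dN; rewrite -jN -[j.+1%:R]natr1 mulrDr mulr1 mulrC; lra.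
  move: dN; rewrite -jN -[j.+1%:R]natr1 mulrDr mulr1 mulrC /cell mul0r; lra.
rewrite modn_small// /cell -[j.+1%:R]natr1 mulrDl mul1r ifT; first by lra.
(* The branch condition remains: since [j.+2 <= N], cell [j] ends at or below [1 - d]. *)
have : (j.+2)%:R * d <= N%:R * d by rewrite ler_wpM2r ?(ltW d0)// ler_nat.
rewrite [N%:R * _]mulrC dN -addn2 natrD mulrDl; lra.
Qed.

Lemma iter_rotate_cell j t k : (j < N)%N -> 0 < t <= d ->
  iter k (rotate d) (cell j t) = cell ((j + k) %% N) t.
Proof.
move=> jN td; elim: k => [|k IH]; first by rewrite addn0 modn_small.
rewrite iterS IH rotate_cell ?ltn_mod ?expn_gt0//; congr cell.
by rewrite addnS -addn1 modnDml addn1.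
Qed.

Lemma cell_le j t : (j < N)%N -> 0 < t <= d ->
  (cell j t <= 1 - d) = (j.+1 != N).
Proof.
move=> jN /andP[t0 td]; have d0 := step_gt0; have dN := stepM_card.
have [jE|jE] := eqVneq j.+1 N.
  apply/negbTE; rewrite -ltNge /cell.
  by move: dN; rewrite -jE -[j.+1%:R]natr1 mulrDr mulr1 mulrC; lra.
have : (j.+2)%:R * d <= N%:R * d.
  by rewrite ler_wpM2r ?(ltW d0)// ler_nat ltn_neqAle jE.
rewrite [N%:R * _]mulrC dN -addn2 natrD mulrDl /cell => ?; apply/idP => /=; lra.
Qed.

Lemma cellP x : 1 / 2 < x <= 1 ->
  exists j t, [/\ (j < N)%N, 0 < t <= d & x = cell j t].
Proof.
move=> /andP[x2 x1].
(* Generalised to the first [M] cells for induction: a point beyond these lies in cell [M]. *)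
have aux M : x <= 1 / 2 + M%:R * d ->
    exists j t, [/\ (j < M)%N, 0 < t <= d & x = cell j t].
  elim: M => [|M IH]; first by rewrite mul0r; lra.
  case: (leP x (1 / 2 + M%:R * d)) => [/IH [j [t [jM td xE]]]|xM].
    by exists j, t; split => //; exact: ltnW.
  rewrite -[M.+1%:R]natr1 mulrDl mul1r => xM1.
  exists M, (x - (1 / 2 + M%:R * d)); split => //; last by rewrite /cell; lra.
  by apply/andP; split; lra.
by apply: aux; rewrite [N%:R * _]mulrC stepM_card; lra.
Qed.

Lemma iter_rotate_low k x : x <= 1 / 2 -> iter k (rotate d) x = x.
Proof. by move=> x2; elim: k => //= k ->; rewrite /rotate x2. Qed.

Lemma iter_rotate_id x : 0 <= x <= 1 -> iter N (rotate d) x = x.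
Proof.
move=> /andP[x0 x1]; have [x2|x2] := leP x (1 / 2); first exact: iter_rotate_low.
have [|j [t [jN td ->]]] := @cellP x; first by rewrite x2.
by rewrite iter_rotate_cell// modnDr modn_small.
Qed.

(* Exactly one of the [N] iterates of a point of [(1/2, 1]] exceeds [1 - d]. *)
Lemma prod_orbit_signs (C : comNzRingType) x (z : C) : 0 <= x <= 1 ->
  \prod_(1 <= k < N.+1)
    (1 + (if iter k (rotate d) x <= 1 - d then -1 else 1) * z) =
  (1 + (if x <= 1 / 2 then -1 else 1) * z) * (1 - z) ^+ (N - 1).
Proof.
move=> /andP[x0 x1]; have N0 : (0 < N)%N by rewrite expn_gt0.
have [x2|x2] := leP x (1 / 2).
  rewrite (eq_bigr (fun=> 1 - z)); last first.
    move=> k _; rewrite iter_rotate_low// ifT ?mulN1r//.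
    by have := step_le_half; lra.
  by rewrite prodr_const_nat subSS subn0 mulN1r -exprS -subSn// subSS subn0.
have [|j [t [jN td ->]]] := @cellP x; first by rewrite x2.
(* The only time in [1..N] at which the orbit from cell [j] is in the last cell: [j + k0] is [N - 1]
   modulo [N], with [N] replacing the time 0 when [j] is already the last cell. *)
pose k0 := if j.+1 == N then N else (N - j.+1)%N.
have k0P : (0 < k0 <= N)%N by rewrite /k0; case: eqP => ?; lia.
have kP k : (0 < k <= N)%N ->
    (iter k (rotate d) (cell j t) <= 1 - d) = (k != k0).
  move=> kN; rewrite iter_rotate_cell// cell_le// ?ltn_mod//.
  congr negb; rewrite /k0; have [jk|jk] := ltnP (j + k) N.
    rewrite modn_small//; case: (eqVneq j.+1 N) => ?; lia.
  have -> : ((j + k) %% N = j + k - N)%N.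
    by rewrite -{1}(subnK jk) modnDr modn_small//; lia.
  case: (eqVneq j.+1 N) => ?; lia.
(* Isolate the factor at [k0]; the [k0 - 1] factors before it and the [N - k0] after it all equal
   [1 - z]. *)
rewrite (big_cat_nat (n := k0))/=; [|lia..].
rewrite [X in _ * X]big_ltn; last by lia.
rewrite (kP k0)// eqxx/= mulrCA; congr (_ * _).
rewrite [X in X * _](@eq_big_nat _ _ _ _ _ _ (fun=> 1 - z)); last first.
  move=> k k1; rewrite kP; last by lia.
  have -> : k != k0 by lia.
  by rewrite mulN1r.
rewrite [X in _ * X](@eq_big_nat _ _ _ _ _ _ (fun=> 1 - z)); last first.
  move=> k k1; rewrite kP; last by lia.
  have -> : k != k0 by lia.
  by rewrite mulN1r.
by rewrite !prodr_const_nat -exprD; congr (_ ^+ _); lia.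
Qed.

End orbits.

End interval_rotation.

(** * Cylinders generate the Borel sets of the product space *)

Section cylinders.
Variable R : realType.
Implicit Types (J : seq primeT) (A : primeT -> set R).

Definition cylinder J A : set (Omega R) :=
  [set w | forall p, p \in J -> A p (unit_val (w p))].

Definition cylinders : set (set (Omega R)) :=
  [set X | exists J A, [/\ uniq J, forall p, measurable (A p) & X = cylinder J A]].

Lemma cylindersI : setI_closed cylinders.
Proof.
move=> _ _ [J [A [uJ mA ->]]] [J' [A' [uJ' mA' ->]]].
(* A coordinate missing from one of the lists is left unconstrained there by [setT]. *)
exists (undup (J ++ J')), (fun p => (if p \in J then A p else setT) `&`
                            (if p \in J' then A' p else setT)).
split; first exact: undup_uniq.
  by move=> p; apply: measurableI; case: ifP.
apply/seteqP; split => w /=.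
  by move=> [Jw J'w] p _; split; case: ifP => // ?; [exact: Jw|exact: J'w].
move=> H; split=> p pJ; have := H p; rewrite mem_undup mem_cat pJ ?orbT.
  by move=> /(_ isT)[].
by move=> /(_ isT)[_].
Qed.

Lemma open_coordinate (p : primeT) (U : set R) : open U ->
  open ([set w | U (unit_val (w p))] : set (Omega_top R)).
Proof.
move=> oU; set E := (X in open X).
exists [set E]; last by rewrite bigcup_set1.
move=> _ ->; apply: (@finI_from1 _ _ _ id); exists p => //.
by exists [set u | U (unit_val u)] => //; exists U.
Qed.

(** Coordinate maps pull open intervals back to open sets, and open intervals generate the Borel
    sets of the line. *)
Lemma measurable_coordinate (p : primeT) (B : set R) : measurable B ->
  measurable ([set w | B (unit_val (w p))] : set (Omega R)).
Proof.
move=> mB.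
have mf : measurable_fun [set: Omega R] (fun w : Omega R => unit_val (w p)).
  apply: (measurability _ (RGenOpens.measurableE R)).
  move=> _ [_ [a [b ->] <-]]; rewrite setTI.
  by apply: sub_sigma_algebra; apply: open_coordinate; exact: interval_open.
by rewrite -[X in measurable X]setTI; exact: mf.
Qed.

Lemma measurable_cylinder J A : (forall p, measurable (A p)) ->
  measurable (cylinder J A).
Proof.
move=> mA; elim: J => [|p J IH].
  by rewrite (_ : cylinder _ _ = setT)//; apply/seteqP; split.
rewrite (_ : cylinder _ _ = [set w | A p (unit_val (w p))] `&` cylinder J A).
  by apply: measurableI => //; exact: measurable_coordinate.
apply/seteqP; split => w /=.
  by move=> H; split; [apply: H; rewrite mem_head|
    move=> q qJ; apply: H; rewrite inE qJ orbT].
by move=> [H1 H2] q; rewrite inE => /orP[/eqP ->|/H2].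
Qed.

(** The codes [c] form a countable type, which makes unions of boxes countable. A prime may occur
    several times; its constraints are then intersected. *)
Definition rat_box (c : seq (primeT * (rat * rat))) : set (Omega R) :=
  [set w | forall x, x \in c -> ratr x.2.1 < unit_val (w x.1) < ratr x.2.2].

(** Each set of the finite list constrains a single coordinate, so one rational interval around that
    coordinate of [w] suffices for it. *)
Lemma rat_box_nbhs (w : Omega R) (s : seq (set (Omega_top R))) :
  (forall E, E \in s ->
     E w /\ exists (p : primeT) (V : set R), open V /\
       E = [set v | V (unit_val (v p))]) ->
  exists c, rat_box c w /\ forall E, E \in s -> rat_box c `<=` E.
Proof.
elim: s => [|E s IH] sP; first by exists [::]; split.
have [|c [cw cs]] := IH.
  by move=> F Fs; apply: sP; rewrite inE Fs orbT.
have [Ew [p [V [oV EE]]]] := sP E (mem_head _ _).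
have Vw : V (unit_val (w p)) by move: Ew; rewrite EE.
have := open_nbhs_nbhs (conj oV Vw).
move=> /nbhs_ballP[e /= e0 eV].
have [q1 /[!in_itv]/= /andP[q1l q1r]] :
    exists q, ratr q \in `](unit_val (w p) - e), (unit_val (w p))[.
  by apply: rat_in_itvoo; rewrite ltrBlDr ltrDl.
have [q2 /[!in_itv]/= /andP[q2l q2r]] :
    exists q, ratr q \in `](unit_val (w p)), (unit_val (w p) + e)[.
  by apply: rat_in_itvoo; rewrite ltrDl.
exists ((p, (q1, q2)) :: c); split.
  by move=> x; rewrite inE => /orP[/eqP -> /=|/cw//]; rewrite q1r q2l.
move=> F; rewrite inE => /orP[/eqP ->|Fs] v vc; last first.
  by apply: cs Fs _ _ => x xc; apply: vc; rewrite inE xc orbT.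
rewrite EE /=; apply: eV.
have /= /andP[v1 v2] := vc _ (mem_head _ _).
rewrite -ball_normE /= ltr_norml; apply/andP; split; lra.
Qed.

(** An open set of the product topology is a union of finite intersections of subbasic sets;
    [rat_box_nbhs] is applied to one intersection containing [w]. *)
Lemma rat_box_basis (U : set (Omega_top R)) (w : Omega R) : open U -> U w ->
  exists c, rat_box c w /\ rat_box c `<=` U.
Proof.
move=> [B sB <-] [C BC Cw].
have [D sD DC] := sB _ BC.
have [|c [cw cD]] := @rat_box_nbhs w (finmap.enum_fset D).
  move=> E ED; split; first by move: Cw; rewrite -DC; apply.
  have /set_mem[p _ [W [V oV VW] WE]] := sD _ ED.
  by exists p, V; split => //; rewrite -WE -VW.
exists c; split => // v cv; exists C => //.
suff : C v by [].
by rewrite -DC => E ED; exact: cD ED _ cv.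
Qed.

Lemma measurable_cylinders :
  (measurable : set (set (Omega R))) = <<s cylinders >>.
Proof.
(* The same points with the sigma-algebra generated by cylinders, so that closure properties can be
   used for it. *)
pose Oc := g_sigma_algebraType cylinders.
apply/seteqP; split; last first.
  apply: smallest_sub; first exact: sigma_algebra_measurable.
  by move=> _ [J [A [_ mA ->]]]; exact: measurable_cylinder.
apply: smallest_sub; first exact: smallest_sigma_algebra.
move=> U oU.
have mbox c : (measurable : set (set Oc)) (rat_box c).
  elim: c => [|x c IH].
    by rewrite (_ : rat_box _ = setT)//; apply/seteqP; split.
  pose I : set R := [set` `](ratr x.2.1), (ratr x.2.2)[].
  rewrite (_ : rat_box _ = cylinder [:: x.1] (fun=> I) `&` rat_box c).
    apply: (@measurableI _ Oc) => //; apply: sub_sigma_algebra.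
    by exists [:: x.1], (fun=> I); split => // p; exact: measurable_itv.
  apply/seteqP; split => w /=.
    move=> H; split.
      by move=> p; rewrite inE => /eqP ->; rewrite /I/= in_itv/= H// mem_head.
    by move=> y yc; apply: H; rewrite inE yc orbT.
  move=> [H1 H2] y; rewrite inE => /orP[/eqP ->|/H2//].
  by have := H1 x.1 (mem_head _ _); rewrite /I/= in_itv.
(* The union runs over all codes, boxes not contained in [U] being replaced by the empty set. *)
have -> : U = \bigcup_c (if `[< rat_box c `<=` U >] then rat_box c else set0).
  apply/seteqP; split => w.
    by move=> /(rat_box_basis oU)[c [cw cU]]; exists c => //; rewrite asboolT.
  by move=> [c _]; case: ifPn => // /asboolP; exact.
apply: (@countable_bigcupT_measurable _ Oc) => //.
by move=> c; case: ifPn => _; [exact: mbox|exact: (@measurable0 _ Oc)].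
Qed.

End cylinders.

(** * The rotation of all coordinates preserves the product measure *)

Section coordinatewise_rotation.
Variables (R : realType) (d : R).
Hypotheses (d0 : 0 < d) (d2 : d <= 1 / 2).

Lemma rotate_unit_subproof (u : unit_itv R) :
  rotate d (unit_val u) \in (`[0, 1]%classic : set R).
Proof.
rewrite inE/= in_itv/=; apply: rotate_itv => //.
by have := valP u; rewrite inE/= in_itv.
Qed.

Definition rotate_unit (u : unit_itv R) : unit_itv R :=
  SigSub (rotate_unit_subproof u).

Definition rotate_Omega (w : Omega R) : Omega R := fun p => rotate_unit (w p).

Lemma unit_val_iter_rotate k (w : Omega R) p :
  unit_val (iter k rotate_Omega w p) = iter k (rotate d) (unit_val (w p)).
Proof. by elim: k => //= k <-. Qed.

Lemma preimage_rotate_cylinder J A :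
  rotate_Omega @^-1` cylinder J A = cylinder J (fun p => rotate d @^-1` A p).
Proof. by []. Qed.

Lemma measurable_rotate_Omega : measurable_fun setT rotate_Omega.
Proof.
apply: (measurability _ (measurable_cylinders R)).
move=> _ [_ [J [A [_ mA ->]]] <-]; rewrite setTI preimage_rotate_cylinder.
by apply: measurable_cylinder => p; exact: measurable_rotate.
Qed.

(** By the product rule and the invariance in each coordinate, [P] and its image agree on cylinders,
    a generating pi-system, hence everywhere. *)
Lemma measure_preserving_rotate_Omega (P : probability (Omega R) R) :
  is_product_lebesgue P -> measure_preserving P rotate_Omega.
Proof.
move=> PL; split; first exact: measurable_rotate_Omega.
move=> A mA; apply/esym.
pose m2 := measure_function_pushforward__canonical__measure_function_Measure
  P measurable_rotate_Omega.
(* The exhausting sequence is constantly the whole space, a cylinder over the empty list. *)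
apply: (@measure_unique _ _ _ (@cylinders R) (fun=> setT)
  (measurable_cylinders R) (@cylindersI R) _ _ P m2) => //.
- move=> _; exists [::], (fun=> setT); split => //.
  by apply/seteqP; split.
- by rewrite bigcup_const.
- move=> _ [J [B [uJ mB ->]]].
  rewrite /m2/= /pushforward preimage_rotate_cylinder [LHS]PL// [RHS]PL//; last first.
    by move=> p; exact: measurable_rotate.
  by apply: eq_bigr => p _; rewrite lebesgue_measure_rotate.
- by move=> _; apply: le_lt_trans (probability_le1 P measurableT) _; rewrite ltry.
Qed.

End coordinatewise_rotation.

(** * The transformation and the identity of Dirichlet series *)

Theorem theorem1 (R : realType) (n : nat) (P : probability (Omega R) R)
    (f : R -> nat -> Omega R -> R[i]) :
  (1 <= n)%N ->
  is_product_lebesgue P ->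
  (forall alpha : R, 1 / 2 <= alpha <= 1 ->
     is_random_multiplicative alpha (f alpha)) ->
  let beta : R := 1 - 1 / 2 ^+ n.+1 in
  let F (alpha : R) (s : R[i]) (w : Omega R) : R[i] :=
    dirichlet_series (fun m => f alpha m w) s in
  exists T : Omega R -> Omega R,
    [/\ measure_preserving P T,
        (forall w, iter (2 ^ n) T w = w)
      & forall (s : R[i]) (w : Omega R), 1 < complex.Re s ->
          1 / riemann_zeta s ^+ (2 ^ n - 1) =
          1 / F (1 / 2) s w * \prod_(1 <= k < (2 ^ n).+1) F beta s (iter k T w)].
Proof.
move=> _ PL fP beta F.
pose T := rotate_Omega (step_gt0 R n) (step_le_half R n).
have half_beta : 1 / 2 <= beta <= 1.
  by have := step_gt0 R n; have := step_le_half R n; rewrite /beta => *; lra.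
have half_half : (1 / 2 : R) <= (1 / 2 : R) <= (1 : R).
  by lra.
have unit_itvP (w : Omega R) (p : primeT) : 0 <= unit_val (w p) <= 1.
  by have := valP (w p); rewrite inE/= in_itv.
(* Coordinates lie in [[0, 1]], so the two sign conditions on [f] cover every case and reduce to one
   comparison. *)
have f_sign alpha w p (pp : prime p) : 1 / 2 <= alpha <= 1 ->
    f alpha p w = if unit_val (w (exist _ p pp)) <= alpha then -1 else 1.
  move=> /fP/(_ w)[_ _ fm fp]; have /andP[w0 w1] := unit_itvP w (exist _ p pp).
  case: leP => wa.
    by apply: (fm (exist _ p pp)); rewrite in_itv/= w0.
  by apply: (fp (exist _ p pp)); rewrite in_itv/= wa.
have f_le1 alpha w p : 1 / 2 <= alpha <= 1 -> prime p -> `|f alpha p w| <= 1.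
  by move=> al pp; rewrite (f_sign _ _ _ pp al); case: ifP; rewrite ?normrN1 ?normr1.
exists T; split.
- exact: measure_preserving_rotate_Omega.
- move=> w; apply/funext => p; apply: val_inj.
  have := unit_val_iter_rotate (step_gt0 R n) (step_le_half R n) (2 ^ n) w p.
  by rewrite iter_rotate_id.
- move=> s w s1; apply: dirichlet_series_prod => //.
  + by have [] := fP _ half_half w.
  + by have [] := fP _ half_half w.
  + by move=> p; exact: f_le1.
  + by move=> k; have [] := fP _ half_beta (iter k T w).
  + by move=> k; have [] := fP _ half_beta (iter k T w).
  + by move=> k p; exact: f_le1.
  (* The Euler factors at [p] depend only on the orbit of the coordinate of [w] at [p], which
     [prod_orbit_signs] describes. *)
  + move=> p x pp; rewrite (f_sign _ w _ pp half_half).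
    rewrite -prod_orbit_signs//; apply: eq_bigr => k _.
    by rewrite (f_sign _ _ _ pp half_beta) unit_val_iter_rotate.
Qed.
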